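(* Let $\mathcal X$ be a Banach lattice with order unit $\mathbf e$ and the norm induced by $\mathbf e$, and let $\mathcal Q\subset\mathcal X'$ be a non-empty, closed, convex set for which there is a closed subspace $\mathcal H_{\mathcal Q}\subset\mathcal X$ with $\mathcal Q=\mathcal H_{\mathcal Q}^\perp\cap\partial B'_+$. Then the following are equivalent: 1. There exists a subspace $\mathfrak H$ of $\mathcal X''$ such that $\mathbf P(\mathfrak a;\mathcal Q)=\mathbf D(\mathfrak a;\mathfrak H+\mathcal X''_-)$ for all $\mathfrak a\in\mathcal X''$. 2. $\mathfrak A_{\mathcal Q}=\mathfrak K_{\mathcal Q}$. 3. $\mathbf P(\mathfrak a;\mathcal Q)=\mathbf D(\mathfrak a;\mathfrak A_{\mathcal Q})$ for all $\mathfrak a\in\mathcal X''$. 4. $\overline{\mathfrak I(\hat{\mathcal A}_{\mathcal Q})}^{\,*}\cap\mathcal X'''_+=\overline{\mathfrak I(\mathcal C_{\mathcal Q})}^{\,*}$. Moreover, when a subspace $\mathfrak H$ satisfies (1), then $\mathfrak H\subset\hat{\mathfrak H}_{\mathcal Q}$ and the strong closure of $\mathfrak H+\mathcal X''_-$ is equal to $\mathfrak K_{\mathcal Q}$.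
   Context: $\mathcal X$ is a real Banach lattice with an order unit $\mathbf e\in\mathcal X_+$ and norm $\|f\|_{\mathcal X}=\inf\{c\in\mathbb R: -c\,\mathbf e\le f\le c\,\mathbf e\}$. $\mathcal X',\mathcal X'',\mathcal X'''$ are the successive topological duals, each with the order dual to that of the previous space; the subscripts $+$ and $-$ denote positive and negative elements. $\mathfrak I$ denotes the canonical embedding of a space into its bidual: $\mathcal X\to\mathcal X''$, and in condition (4) $\mathcal X'\to\mathcal X'''$. $\partial B'_+=\{\eta\in\mathcal X'_+:\eta(\mathbf e)=1\}$ is the positive part of the unit sphere of $\mathcal X'$. For a subset $A$ of a Banach space $\mathcal Z$, $A^\perp=\{\eta\in\mathcal Z':\eta(a)=0\ \forall a\in A\}$. Put: - $\mathcal C_{\mathcal Q}=\{\lambda\eta:\eta\in\mathcal Q,\ \lambda\ge0\}$; - $\hat{\mathcal A}_{\mathcal Q}=\mathcal C_{\mathcal Q}-\mathcal C_{\mathcal Q}$, the linear span of $\mathcal Q$ in $\mathcal X'$; - $\hat{\mathfrak H}_{\mathcal Q}=\hat{\mathcal A}_{\mathcal Q}^\perp\subset\mathcal X''$; - $\mathfrak A_{\mathcal Q}=\overline{\hat{\mathfrak H}_{\mathcal Q}+\mathcal X''_-}$ (strong, i.e. norm, closure in $\mathcal X''$); - $\mathfrak K_{\mathcal Q}=\{\mathfrak z\in\mathcal X'':\mathfrak z(\eta)\le0\ \forall\eta\in\mathcal Q\}$. For a subset $B$ of the dual of a Banach space, $\overline B^{\,*}$ is its weak$^*$ closure; in condition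 (4) this is the weak$^*$ topology $\sigma(\mathcal X''',\mathcal X'')$. For $\mathfrak a\in\mathcal X''$ and $\mathfrak K\subset\mathcal X''$: $\mathbf P(\mathfrak a;\mathcal Q)=\sup_{\eta\in\mathcal Q}\mathfrak a(\eta)$ and $\mathbf D(\mathfrak a;\mathfrak K)=\inf\{c\in\mathbb R:\exists\,\mathfrak z\in\mathfrak K\text{ with }c\,\mathfrak I(\mathbf e)+\mathfrak z=\mathfrak a\}$, with $\inf\emptyset=+\infty$. *)

(* Defs.v *)
From HB Require Import structures.
From mathcomp Require Import all_boot all_order all_algebra.
From mathcomp Require Import all_classical all_reals all_analysis.

Set Implicit Arguments.
Unset Strict Implicit.
Unset Printing Implicit Defensive.

Import Order.TTheory GRing.Theory Num.Theory.
Import numFieldNormedType.Exports.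

Local Open Scope classical_set_scope.
Local Open Scope ring_scope.

(* The order is a field of the mixin because the hierarchy admits no structure
   inheriting from both [Order.Lattice] and [CompleteNormedModule]: number
   domains already inherit from the parents of both. *)
HB.mixin Record isBanachLattice (R : realType) V
    & CompleteNormedModule R V := {
  vle : rel V ;
  vmeet : V -> V -> V ;
  vjoin : V -> V -> V ;
  vle_refl : reflexive vle ;
  vle_anti : antisymmetric vle ;
  vle_trans : transitive vle ;
  vle_meet : forall x y z, vle x (vmeet y z) = vle x y && vle x z ;
  vle_join : forall x y z, vle (vjoin x y) z = vle x z && vle y z ;
  vleD2r : forall z x y, vle x y -> vle (x + z) (y + z) ;
  vleZ2l : forall (a : R) x y, 0 <= a -> vle x y -> vle (a *: x) (a *: y) ;
  vle_norm : forall x y, vle (vjoin x (- x)) (vjoin y (- y)) -> `|x| <= `|y|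
}.

#[short(type="banachLatticeType")]
HB.structure Definition BanachLattice (R : realType) :=
  {V of CompleteNormedModule R V & isBanachLattice R V}.

Section OrderUnit.
Context (R : realType) (X : banachLatticeType R).

Definition pos_cone : set X := [set x | vle 0 x].

Definition order_unit (e : X) :=
  pos_cone e /\
  forall f : X, exists c : R, vle (- (c *: e)) f /\ vle f (c *: e).

Definition order_unit_norm (e : X) :=
  forall f : X,
    `|f| = inf [set c : R | vle (- (c *: e)) f /\ vle f (c *: e)].

End OrderUnit.

Section Dual.
Context (R : realType) (V : normedModType R).

Definition lin_cont : {pred V -> R^o} :=
  mem [set f : V -> R^o | linear f /\ continuous f].

Record topdual := Dual { dual_fun :> V -> R^o ; dualP : dual_fun \in lin_cont }.

HB.instance Definition _ := [isSub for dual_fun].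
HB.instance Definition _ := [Choice of topdual by <:].

Fact lin_cont_submod : submod_closed lin_cont.
Proof.
split; first by rewrite inE; split=> [a x y|x] /=;
  [rewrite scaler0 addr0|exact: cvg_cst].
move=> a f g; rewrite !inE => -[lf cf] [lg cg]; split.
  move=> b x y; have := lf b x y; have := lg b x y.
  rewrite !fctE /= => -> ->.
  by rewrite !scalerDr !scalerA [a * b]mulrC addrACA.
move=> x; apply: (@cvgD _ _ _ (nbhs x) _ (a \*: f) g _ _ _ (cg x)).
by apply: cvgZr; exact: cf.
Qed.

HB.instance Definition _ :=
  GRing.isSubmodClosed.Build R (V -> R^o) lin_cont lin_cont_submod.
HB.instance Definition _ := [SubChoice_isSubLmodule of topdual by <:].

Lemma dual_linear (f : topdual) : linear f.
Proof. by have := dualP f; rewrite inE => -[]. Qed.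

Lemma dual_continuous (f : topdual) : continuous f.
Proof. by have := dualP f; rewrite inE => -[]. Qed.

HB.instance Definition _ (f : topdual) :=
  GRing.isLinear.Build R V R^o _ (dual_fun f) (dual_linear f).

Definition dual_norm (f : topdual) : R :=
  sup [set `|f x| | x in [set x : V | `|x| <= 1]].

Lemma dualE (f g : topdual) : f =1 g -> f = g.
Proof. by move=> fg; apply: val_inj; apply: funext. Qed.

Lemma dualDE (f g : topdual) x : (f + g) x = f x + g x.
Proof. by []. Qed.

Lemma dualZE a (f : topdual) x : (a *: f) x = a * f x.
Proof. by []. Qed.

Lemma dual_ball_has_sup (f : topdual) :
  has_sup [set `|f x| | x in [set x : V | `|x| <= 1]].
Proof.
split; first by exists `|f 0|; exists 0 => //=; rewrite normr0 ler01.
have /linear_bounded_continuous/bounded_funP/(_ 1)[M fM] := @dual_continuous f.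
by exists M => _ [x /= x1 <-]; exact: fM.
Qed.

Lemma dual_norm_ball (f : topdual) x : `|x| <= 1 -> `|f x| <= dual_norm f.
Proof. by move=> x1; apply: sup_upper_bound (dual_ball_has_sup f) _ _; exists x. Qed.

Lemma dual_norm_le (f : topdual) M :
  (forall x, `|x| <= 1 -> `|f x| <= M) -> dual_norm f <= M.
Proof.
move=> fM; apply: ge_sup; first by have [] := dual_ball_has_sup f.
by move=> _ [x /= x1 <-]; exact: fM.
Qed.

Lemma dual_norm_apply (f : topdual) x : `|f x| <= dual_norm f * `|x|.
Proof.
have [->|x0] := eqVneq x 0; first by rewrite linear0 !normr0 mulr0.
have nx0 : 0 < `|x| by rewrite normr_gt0.
rewrite -ler_pdivrMr//.
have := @dual_norm_ball f (`|x|^-1 *: x).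
rewrite linearZ/= !normrZ normfV normr_id mulVf ?gt_eqF// => /(_ (lexx _)).
by rewrite mulrC.
Qed.

Fact dual_normD (f g : topdual) : dual_norm (f + g) <= dual_norm f + dual_norm g.
Proof.
apply: dual_norm_le => x x1; rewrite dualDE (le_trans (ler_normD _ _))//.
by apply: lerD; exact: dual_norm_ball.
Qed.

Fact dual_normZ (a : R) (f : topdual) : dual_norm (a *: f) = `|a| * dual_norm f.
Proof.
have le b g : dual_norm (b *: g) <= `|b| * dual_norm g.
  apply: dual_norm_le => x x1; rewrite dualZE normrM ler_wpM2l//.
  exact: dual_norm_ball.
apply/eqP; rewrite eq_le le /=.
have [->|a0] := eqVneq a 0.
  rewrite normr0 mul0r; apply: le_trans (dual_norm_ball _ (_ : `|0| <= 1)) => //.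
  by rewrite normr0.
rewrite -ler_pdivlMl ?normr_gt0//.
by have := le a^-1 (a *: f); rewrite scalerA mulVf// scale1r normfV.
Qed.

Fact dual_norm0_eq0 (f : topdual) : dual_norm f = 0 -> f = 0.
Proof.
move=> f0; apply: dualE => x; apply/eqP; rewrite -normr_le0.
by have := dual_norm_apply f x; rewrite f0 mul0r.
Qed.

HB.instance Definition _ :=
  Lmodule_isNormed.Build R topdual dual_normD dual_normZ dual_norm0_eq0.

End Dual.

Section DualNotions.
Context (R : realType) (V : normedModType R).

Fact bidual_embed_subproof (x : V) :
  (fun f : topdual V => f x) \in @lin_cont R (topdual V).
Proof.
rewrite inE; split; first by [].
have lin : linear (fun f : topdual V => f x : R^o) by [].
pose L := GRing.isLinear.Build R (topdual V) R^o _ _ lin.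
pose ev : {linear topdual V -> R^o} := HB.pack (fun f : topdual V => f x : R^o) L.
apply: (@bounded_linear_continuous _ _ _ ev); apply/bounded_funP => r.
exists (r * `|x|) => f fr; apply: le_trans (dual_norm_apply f x) _.
exact: ler_wpM2r.
Qed.

Definition bidual_embed (x : V) : topdual (topdual V) := Dual (bidual_embed_subproof x).

(* Positive cone of the dual order, the positive cone of [V] being [C]. *)
Definition dual_cone (C : set V) : set (topdual V) :=
  [set f | forall x, C x -> 0 <= f x].

Definition annihilator (A : set V) : set (topdual V) :=
  [set f | forall a, A a -> f a = 0].

Definition weak_star_closure (B : set (topdual V)) : set (topdual V) :=
  @closure (initial_topology (fun f : topdual V => (f : {ptws V -> R^o}))) B.

Definition set_add (A B : set V) : set V := [set x + y | x in A & y in B].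

Definition linear_subspace (H : set V) := submod_closed [in H].

Definition convex_subset (A : set V) :=
  convex_set (A : set (convex_lmodType V)).

End DualNotions.

Section Duality.
Context (R : realType) (X : banachLatticeType R).

Definition dual_pos : set (topdual X) := dual_cone (@pos_cone R X).
Definition bidual_pos : set (topdual (topdual X)) := dual_cone dual_pos.
Definition bidual_neg : set (topdual (topdual X)) :=
  [set - z | z in bidual_pos].
Definition tridual_pos : set (topdual (topdual (topdual X))) :=
  dual_cone bidual_pos.

Definition pos_sphere (e : X) : set (topdual X) :=
  [set eta | dual_pos eta /\ eta e = 1].

Definition primal (a : topdual (topdual X)) (Q : set (topdual X)) : \bar R :=
  ereal_sup [set (a eta)%:E | eta in Q].

Definition dual_value (e : X) (a : topdual (topdual X))
    (K : set (topdual (topdual X))) : \bar R :=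
  ereal_inf [set c%:E | c in
    [set c : R | exists2 z, K z & c *: bidual_embed e + z = a]].

Definition no_duality_gap (e : X) (Q : set (topdual X))
    (H : set (topdual (topdual X))) :=
  forall a : topdual (topdual X),
    primal a Q = dual_value e a (set_add H bidual_neg).

Section Constraints.
Variable Q : set (topdual X).

Definition cone_hull : set (topdual X) :=
  [set l *: eta | l in [set l : R | 0 <= l] & eta in Q].

Definition span_hull : set (topdual X) :=
  [set f - g | f in cone_hull & g in cone_hull].

Definition Hhat : set (topdual (topdual X)) := annihilator span_hull.

Definition Afrak : set (topdual (topdual X)) :=
  closure (set_add Hhat bidual_neg).

Definition Kfrak : set (topdual (topdual X)) :=
  [set z | forall eta, Q eta -> z eta <= 0].

End Constraints.

End Duality.

Arguments bidual_neg {R} X.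
Arguments tridual_pos {R} X.

(* Main.v *)
From HB Require Import structures.
Require Import Defs.
From mathcomp Require Import all_boot all_order all_algebra.
From mathcomp Require Import all_classical all_reals all_analysis.
From mathcomp Require Import lra.

(** The dual value of [a] only depends on how far [a] must be moved down along
    the unit [E := bidual_embed e] before it lands in the constraint set.  The
    norm of a positive functional on [X] is its value at [e], so every [z] of
    the bidual satisfies [z <= `|z| E].  Hence, for a set [M] which is closed
    under adding negative elements, a point is in the norm closure of [M] iff
    lowering it by an arbitrarily small multiple of [E] puts it in [M]
    ([down_closed_closureP]).  On the primal side, [E] is [1] on [Q], so
    [primal a Q <= c] says exactly that [a - c E] belongs to [Kfrak Q].
    Together: [M] has no duality gap iff [closure M = Kfrak Q]
    ([duality_gapP]).  Applied to [M = Afrak Q] this is the equivalence of the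
    second and third conditions; applied to [M = H + X''_-] it is the last
    assertion.

    For a subspace [H] without gap, [H] is contained in [Kfrak Q] and so, being
    stable under opposites, vanishes on [Q]: thus [H `<=` Hhat Q], and
    [Kfrak Q = closure (H + X''_-)] is contained in [Afrak Q].  The other
    inclusion always holds, so the first condition implies the second, and
    conversely the second is the equation of [duality_gapP] for [H = Hhat Q].

    The fourth condition is the image of the second under polarity. By the
    bipolar theorem for the weak* topology ([weak_star_bipolar]) the closure of
    the embedded cone hull is the polar of [Kfrak Q], that of the embedded span
    is the polar of [Hhat Q], and the positive cone of the third dual is the
    polar of [X''_-]; so the intersection in the fourth condition is the polar
    of [Hhat Q + X''_-], that is, of its closure [Afrak Q]. A norm-closed
    convex cone is determined by its polar ([prepolar_polar]), so equality of
    the two polars means [Afrak Q = Kfrak Q].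

    Both polarity theorems come from one separation theorem for a cone and a
    point at positive seminorm distance ([cone_separation]), itself a case of
    the Mazur-Orlicz form of the Hahn-Banach theorem ([mazur_orlicz]). *)

Set Implicit Arguments.
Unset Strict Implicit.
Unset Printing Implicit Defensive.

Import Order.TTheory GRing.Theory Num.Theory.
Import numFieldNormedType.Exports.
Local Open Scope classical_set_scope.
Local Open Scope ring_scope.

(** * Sublinear functionals and separation of convex cones *)

Section HahnBanach.
Context (R : realType) (V : lmodType R).

Definition convex_cone (A : set V) :=
  [/\ A !=set0, forall x y, A x -> A y -> A (x + y)
    & forall t x, 0 <= t -> A x -> A (t *: x)].

Lemma convex_cone0 (A : set V) : convex_cone A -> A 0.
Proof. by case=> -[x Ax] _ /(_ 0 x (lexx _) Ax); rewrite scale0r. Qed.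

(** Only the inequality is asked for homogeneity, because it is what passes to
    infima; equality follows, see [sublinearZ]. *)
Definition sublinear (p : V -> R) :=
  (forall x y, p (x + y) <= p x + p y) /\
  (forall t x, 0 <= t -> p (t *: x) <= t * p x).

Lemma sublinearN (p : V -> R) : sublinear p -> forall x, - p (- x) <= p x.
Proof.
move=> [pD _] x; have := pD 0 0; rewrite addr0 => p0.
have := pD x (- x); rewrite subrr; move: p0; lra.
Qed.

Lemma sublinear0 (p : V -> R) : sublinear p -> p 0 = 0.
Proof.
move=> [pD pZ]; have := pD 0 0; have := pZ 0 0 (lexx _).
rewrite scaler0 addr0; lra.
Qed.

Lemma sublinearZ (p : V -> R) t x : sublinear p -> 0 <= t ->
  p (t *: x) = t * p x.
Proof.
move=> p_sub t0; have [_ pZ] := p_sub.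
have [->|t_neq0] := eqVneq t 0; first by rewrite scale0r mul0r sublinear0.
apply/eqP; rewrite eq_le pZ//= -ler_pdivlMl ?lt_def ?t_neq0//.
by have := pZ t^-1 (t *: x); rewrite scalerA mulVf// scale1r invr_ge0; apply.
Qed.

(** The two conditions on [G] are those under which an infimum may be taken
    separately over two members: they hold for chains, and for families indexed
    by a convex cone, which are the two uses below. *)
Lemma sublinear_inf (G : set (V -> R)) :
    G !=set0 ->
    (forall x, has_lbound [set g x | g in G]) ->
    (forall g h x y, G g -> G h -> exists2 k, G k & k (x + y) <= g x + h y) ->
    (forall t g x, 0 <= t -> G g -> exists2 k, G k & k (t *: x) <= t * g x) ->
  sublinear (fun x => inf [set g x | g in G]).
Proof.
move=> [g0 Gg0] Glb GD GZ.
have infG_le x g : G g -> inf [set g x | g in G] <= g x.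
  by move=> Gg; apply: ge_inf => //; exists g.
have le_infG c x : (forall g, G g -> c <= g x) -> c <= inf [set g x | g in G].
  move=> cG; apply: lb_le_inf; first by exists (g0 x), g0.
  by move=> _ [g Gg <-]; exact: cG.
split=> [x y|t x t0].
  rewrite -lerBlDr; apply: (le_infG) => g Gg.
  rewrite lerBlDr -lerBlDl; apply: (le_infG) => h Gh.
  rewrite lerBlDl; have [k Gk] := GD _ _ x y Gg Gh.
  exact: le_trans (infG_le _ _ Gk).
have [t_eq0|t_neq0] := eqVneq t 0.
  have [k Gk] := GZ t g0 x t0 Gg0; rewrite t_eq0 !mul0r; apply: le_trans.
  exact: infG_le.
have t_gt0 : 0 < t by rewrite lt_def t_neq0.
rewrite -ler_pdivrMl//; apply: (le_infG) => g Gg; rewrite ler_pdivrMl//.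
have [k Gk] := GZ t g x t0 Gg; apply: le_trans; exact: infG_le.
Qed.

(** The infimum over [u] in [C] of [q (x + u.1) - u.2] is the largest sublinear
    functional below [q] with the stated property.  The bound [u.2 <= q u.1] on
    [C] is what keeps this infimum finite: it stays above [- q (- x)]. *)
Lemma sublinear_envelope (q : V -> R) (C : set (V * R^o)) :
    sublinear q -> C !=set0 ->
    (forall u v, C u -> C v -> C (u + v)) ->
    (forall t u, 0 <= t -> C u -> C (t *: u)) ->
    (forall u, C u -> u.2 <= q u.1) ->
  exists q', [/\ sublinear q', forall x, q' x <= q x
               & forall u, C u -> q' (- u.1) <= - u.2].
Proof.
move=> q_sub [u0 Cu0] CD CZ Cq; have [qD qZ] := q_sub.
pose G : set (V -> R) := [set (fun x => q (x + u.1) - u.2) | u in C].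
have Glb x : has_lbound [set g x | g in G].
  exists (- q (- x)) => _ [_ [u Cu <-] <-].
  have := qD (x + u.1) (- x); rewrite addrAC subrr add0r.
  by have := Cq _ Cu; lra.
have infG_le x u : C u -> inf [set g x | g in G] <= q (x + u.1) - u.2.
  by move=> Cu; apply: ge_inf => //; eexists; [by exists u|].
exists (fun x => inf [set g x | g in G]); split.
- apply: sublinear_inf => //.
  + by exists (fun x => q (x + u0.1) - u0.2), u0.
  + move=> _ _ x y [u Cu <-] [v Cv <-].
    eexists; first by exists (u + v); [exact: CD|].
    by rewrite /= addrACA; have := qD (x + u.1) (y + v.1); lra.
  + move=> t _ x t0 [u Cu <-].
    eexists; first by exists (t *: u); [exact: CZ|].
    by rewrite /= -scalerDr mulrBr lerD2r; exact: qZ.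
- move=> x; have := infG_le x _ (CZ 0 u0 (lexx _) Cu0).
  by rewrite scale0r/= addr0 subr0.
- move=> u Cu; have := infG_le (- u.1) u Cu.
  by rewrite addNr sublinear0// sub0r.
Qed.

(** Zorn's lemma, for the reverse of the pointwise order: a chain below [p] is
    bounded below at [x] by [- p (- x)], so its pointwise infimum is again
    sublinear. *)
Lemma exists_minimal_sublinear (p : V -> R) : sublinear p ->
  exists q, [/\ sublinear q, forall x, q x <= p x
              & forall q', sublinear q' -> (forall x, q' x <= q x) ->
                  forall x, q x <= q' x].
Proof.
move=> p_sub.
pose T := {q : V -> R | sublinear q /\ forall x, q x <= p x}.
pose ord (q r : T) := `[< forall x, sval r x <= sval q x >].
have p0 : T by exists p.
have [| |F Ftot|q qmin] := @ZL_preorder T p0 ord.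
- by move=> q; apply/asboolP.
- move=> r q s /asboolP rq /asboolP qs; apply/asboolP => x.
  exact: le_trans (qs x) (rq x).
- have [[q0 Fq0]|/set0P/negP/negPn/eqP F0] := pselect (F !=set0); last first.
    by exists p0 => q; rewrite F0.
  pose G := [set sval q | q in F].
  have Glb x : has_lbound [set g x | g in G].
    exists (- p (- x)) => _ [_ [[q [q_sub qp]] Fq <-] <-] /=.
    by have := sublinearN q_sub x; have := qp (- x); lra.
  have infG_le x q : F q -> inf [set g x | g in G] <= sval q x.
    by move=> Fq; apply: ge_inf => //; exists (sval q) => //; exists q.
  have inf_sub : sublinear (fun x => inf [set g x | g in G]).
    apply: sublinear_inf => //.
    + by exists (sval q0), q0.
    + move=> _ _ x y [q Fq <-] [r Fr <-].
      have [/asboolP qr|/asboolP rq] := Ftot _ _ Fq Fr.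
        exists (sval r); first by exists r.
        by have [[rD _] _] := svalP r; have := rD x y; have := qr x; lra.
      exists (sval q); first by exists q.
      by have [[qD _] _] := svalP q; have := qD x y; have := rq y; lra.
    + move=> t _ x t0 [q Fq <-]; exists (sval q); first by exists q.
      by have [[_ qZ] _] := svalP q; exact: qZ.
  have inf_lep x : inf [set g x | g in G] <= p x.
    by apply: le_trans (infG_le x q0 Fq0) _; have [_] := svalP q0.
  pose infG : T := exist _ (fun x => inf [set g x | g in G]) (conj inf_sub inf_lep).
  exists infG => q Fq.
  by apply/asboolP => x; exact: infG_le.
- have [q_sub qp] := svalP q; exists (sval q); split=> // q' q'_sub q'q.
  have q'p x : q' x <= p x by exact: le_trans (q'q x) (qp x).
  pose s : T := exist _ q' (conj q'_sub q'p).
  apply/asboolP/(qmin s).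
  exact/asboolP.
Qed.

(** If [q] is minimal, its envelope along the ray spanned by [(y, q y)] is not
    smaller than [q], yet takes a value at most [- q y] at [- y].  So
    [q (- y) = - q y], and a sublinear functional that is odd is linear. *)
Lemma minimal_sublinear_linear (q : V -> R) : sublinear q ->
    (forall q', sublinear q' -> (forall x, q' x <= q x) ->
       forall x, q x <= q' x) ->
  linear (q : V -> R^o).
Proof.
move=> q_sub qmin; have [qD qZ] := q_sub.
have qN y : q (- y) = - q y.
  pose C : set (V * R^o) :=
    [set (t *: y, t * q y : R^o) | t in [set t : R | 0 <= t]].
  have [||||q' [q'_sub q'q q'C]] := @sublinear_envelope q C q_sub.
  - by exists (0 *: y, 0 * q y), 0 => //=.
  - move=> _ _ [s /= s0 <-] [t /= t0 <-]; exists (s + t); first exact: addr_ge0.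
    by rewrite scalerDl mulrDl.
  - move=> t _ t0 [s /= s0 <-]; exists (t * s); first exact: mulr_ge0.
    by rewrite -scalerA -mulrA.
  - by move=> _ [t /= t0 <-] /=; rewrite sublinearZ.
  have := qmin _ q'_sub q'q (- y).
  have /= := q'C (1 *: y, 1 * q y) (ex_intro2 _ _ 1 ler01 erefl).
  rewrite scale1r mul1r; have := sublinearN q_sub (- y).
  by rewrite opprK; lra.
have qDE x y : q (x + y) = q x + q y.
  apply/eqP; rewrite eq_le qD//=; have := qD (x + y) (- y).
  by rewrite addrK qN; lra.
have qZE t x : q (t *: x) = t * q x.
  have [t0|t0] := leP 0 t; first exact: sublinearZ.
  have := sublinearZ x q_sub (_ : 0 <= - t); rewrite scaleNr qN.
  by move=> /(_ ltac:(lra)); lra.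
by move=> t x y; rewrite qDE qZE.
Qed.

(** The cone [C] lists the lower bounds [u.2] wanted for the values at [u.1];
    imposing them on [p] by an envelope and then descending to a minimal
    functional avoids any extension of partial linear maps. *)
Theorem mazur_orlicz (p : V -> R) (C : set (V * R^o)) :
    sublinear p -> C !=set0 ->
    (forall u v, C u -> C v -> C (u + v)) ->
    (forall t u, 0 <= t -> C u -> C (t *: u)) ->
    (forall u, C u -> u.2 <= p u.1) ->
  exists f : V -> R^o, [/\ linear f, forall x, f x <= p x
                         & forall u, C u -> u.2 <= f u.1].
Proof.
move=> p_sub C0 CD CZ Cp.
have [q [q_sub qp qC]] := sublinear_envelope p_sub C0 CD CZ Cp.
have [f [f_sub fq f_min]] := exists_minimal_sublinear q_sub.
exists f; split; first exact: minimal_sublinear_linear.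
  by move=> x; exact: le_trans (fq x) (qp x).
move=> u Cu; have := sublinearN f_sub u.1; have := fq (- u.1).
by have := qC u Cu; lra.
Qed.

(** The functional must be at least [eps] at [z] and at most [0] on [A], that is,
    at least [t * eps] at [t *: z - a].  These demands form a convex cone, and
    they are compatible with the bound [q]: as [A] is a cone, [t *: z] is at
    [q]-distance at least [t * eps] from it. *)
Theorem cone_separation (q : V -> R) (A : set V) (z : V) (eps : R) :
    sublinear q -> (forall x, 0 <= q x) -> convex_cone A ->
    0 < eps -> (forall a, A a -> eps <= q (z - a)) ->
  exists f : V -> R^o, [/\ linear f, forall x, f x <= q x,
    forall a, A a -> f a <= 0 & 0 < f z].
Proof.
move=> q_sub q_ge0 A_cone eps_gt0 Az; have [_ AD AZ] := A_cone.
have A0 := convex_cone0 A_cone.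
pose C : set (V * R^o) :=
  [set (t *: z - a, t * eps : R^o) | t in [set t : R | 0 <= t] & a in A].
have [||||f [f_lin fq fC]] := @mazur_orlicz q C q_sub.
- by exists (0 *: z - 0, 0 * eps), 0 => //=; exists 0.
- move=> _ _ [s /= s0 [a Aa <-]] [t /= t0 [b Ab <-]].
  exists (s + t); first exact: addr_ge0.
  by exists (a + b); [exact: AD|rewrite scalerDl mulrDl opprD addrACA].
- move=> t _ t0 [s /= s0 [a Aa <-]].
  exists (t * s); first exact: mulr_ge0.
  by exists (t *: a); [exact: AZ|rewrite -scalerA -mulrA -scalerBr].
- move=> _ [t /= t0 [a Aa <-]] /=.
  have [->|t_neq0] := eqVneq t 0; first by rewrite mul0r.
  have t_gt0 : 0 < t by rewrite lt_def t_neq0.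
  have -> : t *: z - a = t *: (z - t^-1 *: a).
    by rewrite scalerBr scalerA mulfV// scale1r.
  by rewrite sublinearZ// ler_pM2l//; apply: Az; apply: AZ; rewrite ?invr_ge0.
pose L := GRing.isLinear.Build R V R^o _ f f_lin.
pose F : {linear V -> R^o} := HB.pack f L.
have FE x : f x = F x by [].
exists f; split=> // [a Aa|].
  have /= := fC (0 *: z - a, 0 * eps) _.
  rewrite scale0r sub0r mul0r FE linearN oppr_ge0; apply.
  by exists 0 => //=; exists a => //; rewrite scale0r sub0r mul0r.
have /= := fC (1 *: z - 0, 1 * eps) _.
rewrite scale1r subr0 mul1r => /(_ _)/(lt_le_trans eps_gt0); apply.
by exists 1 => //=; exists 0 => //; rewrite scale1r subr0 mul1r.
Qed.

End HahnBanach.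

(** * Polars in a normed space and its dual *)

Section Polarity.
Context (R : realType) (V : normedModType R).

Lemma topdual_dominated (f : V -> R^o) :
  linear f -> (forall x, f x <= `|x|) -> exists F : topdual V, F =1 f.
Proof.
move=> f_lin f_le.
pose L := GRing.isLinear.Build R V R^o _ f f_lin.
pose F : {linear V -> R^o} := HB.pack f L.
have f_lin_cont : f \in @lin_cont R V.
  rewrite inE; split=> //.
  apply: (@bounded_linear_continuous _ _ _ F); apply/bounded_funP => r.
  exists r => x xr; apply: le_trans xr; rewrite /= ler_norml f_le andbT lerNl.
  by rewrite -[f]/(F : V -> R^o) -linearN/= -normrN f_le.
by exists (Dual f_lin_cont).
Qed.

Definition polar (A : set V) : set (topdual V) :=
  [set f | forall x, A x -> f x <= 0].

Definition prepolar (B : set (topdual V)) : set V :=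
  [set x | forall f, B f -> f x <= 0].

(** A point outside [A] has a whole ball outside [A], so [cone_separation] applies
    with the norm, and a functional dominated by the norm is continuous. *)
Theorem prepolar_polar (A : set V) :
  closed A -> convex_cone A -> prepolar (polar A) = A.
Proof.
move=> A_closed A_cone; apply/seteqP; split=> [z zA|x Ax f fA]; last exact: fA.
apply: contrapT => nAz.
have : nbhs z (~` A) by apply: open_nbhs_nbhs; split=> //; exact: closed_openC.
move=> /nbhs_normP[eps /= eps_gt0 zeps].
have norm_sub : sublinear (fun x : V => `|x|).
  split=> [x y|t x t0]; first exact: ler_normD.
  by rewrite normrZ ger0_norm.
have [a Aa|f [f_lin f_le fA fz]] :=
  cone_separation norm_sub (@normr_ge0 _ _) A_cone eps_gt0 (z := z).
  rewrite leNgt; apply/negP => za; exact: zeps za Aa.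
have [F Ff] := topdual_dominated f_lin f_le.
have : F z <= 0 by apply: zA => a Aa; rewrite Ff fA.
by rewrite Ff leNgt fz.
Qed.

(** The basic neighbourhoods of the topology of pointwise convergence, written
    with a sum of deviations rather than a maximum, so that sublinearity of the
    deviation can be checked term by term. *)
Lemma weak_star_closureP (B : set (topdual V)) (F : topdual V) :
  weak_star_closure B F <->
  forall (s : seq V) (eps : R), 0 < eps ->
    exists2 b, B b & \sum_(z <- s) `|F z - b z| < eps.
Proof.
pose W := initial_topology (fun f : topdual V => (f : {ptws V -> R^o})).
(* The filter generated by the basic neighbourhoods of [F]; the second half of
   the proof is its convergence to [F]. *)
pose near_on (p : seq V * R) : set (topdual V) :=
  [set b | \sum_(z <- p.1) `|F z - b z| < p.2].
pose G := filter_from [set p : seq V * R | 0 < p.2] near_on.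
have G_filter : Filter G.
  apply: filter_from_filter; first by exists ([::], 1) => /=.
  move=> [s eps] [t del] /= eps0 del0.
  exists (s ++ t, Num.min eps del) => /=; first by rewrite lt_min eps0.
  move=> b; rewrite /near_on /= big_cat/= lt_min => /andP[h1 h2]; split.
    by apply: le_lt_trans h1; rewrite lerDl sumr_ge0.
  by apply: le_lt_trans h2; rewrite lerDr sumr_ge0.
have eval_continuous z : continuous (fun f : W => f z).
  move=> f; apply: (@continuous_comp W {ptws V -> R^o} R^o
      (fun f : topdual V => (f : {ptws V -> R^o})) (fun g => g z)).
    exact: initial_continuous.
  exact: (@proj_continuous V (fun=> R^o) z).
split=> [clF s eps eps0|BF].
  have [b [Bb /= bF]] : B `&` near_on (s, eps) !=set0.
    apply: clF.
    have : \sum_(z <- s) `|F z - b z| @[b --> (F : W)] -->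
        \sum_(z <- s) `|F z - F z|.
      apply: cvg_big => [|z _]; first exact: add_continuous.
      by apply: cvg_norm; apply: cvgB; [exact: cvg_cst|exact: eval_continuous].
    rewrite big1 => [/cvgr_lt|z _]; last by rewrite subrr normr0.
    exact.
  by exists b.
move=> A [_ [[U U_open <-] UF] UA].
have : (fun b : topdual V => (b : {ptws V -> R^o})) @ G --> (F : {ptws V -> R^o}).
  apply/pointwise_cvgP => z; apply/cvgrPdist_lt => eps eps0.
  exists ([:: z], eps) => //= b; rewrite /near_on/= big_seq1; exact.
move=> /(_ U) /(_ (open_nbhs_nbhs (conj U_open UF)))[ [s eps] /= eps0 sU].
by have [b Bb bF] := BF s eps eps0; exists b; split=> //; apply/UA/sU.
Qed.

(** If a functional [F] is not in the closure, finitely many evaluations keep it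
    at positive distance from [B].  Separating the images of [F] and [B] in the
    finite-dimensional space of these evaluations gives a linear form there,
    which is evaluation at a linear combination [z] of the points used: hence
    [z] is in [prepolar B] although [F z > 0]. *)
Theorem weak_star_bipolar (B : set (topdual V)) :
  convex_cone B -> weak_star_closure B = polar (prepolar B).
Proof.
move=> B_cone; apply/seteqP; split=> F.
  move=> /weak_star_closureP clF z zB; apply/ler_addgt0Pl => eps eps0.
  have [b Bb] := clF [:: z] eps eps0; rewrite big_seq1 => /ltW.
  by rewrite ler_norml => /andP[_]; have := zB _ Bb; lra.
move=> F_bipolar; apply/weak_star_closureP => s eps eps0.
apply: contrapT => far.
pose T (g : topdual V) : 'rV[R]_(size s) := \row_i g (tnth (in_tuple s) i).
pose q (x : 'rV[R]_(size s)) := \sum_i `|x 0 i|.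
have q_sub : sublinear q.
  split=> [x y|t x t0].
    rewrite -big_split; apply: ler_sum => i _; rewrite mxE; exact: ler_normD.
  rewrite mulr_sumr; apply: ler_sum => i _.
  by rewrite mxE normrM ger0_norm.
have TB_cone : convex_cone (T @` B).
  have [[b0 Bb0] BD BZ] := B_cone; split; first by exists (T b0), b0.
  - move=> _ _ [b Bb <-] [c Bc <-]; exists (b + c); first exact: BD.
    by apply/rowP => i; rewrite !mxE.
  - move=> t _ t0 [b Bb <-]; exists (t *: b); first exact: BZ.
    by apply/rowP => i; rewrite !mxE.
have [x|_ [b Bb <-]|f [f_lin _ fB fF]] :=
    cone_separation q_sub _ TB_cone eps0 (z := T F).
- by apply: sumr_ge0.
- rewrite leNgt; apply/negP => bF; apply: far; exists b => //.
  rewrite big_tnth; apply: le_lt_trans bF.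
  by apply: ler_sum => i _; rewrite !mxE.
pose L := GRing.isLinear.Build R 'rV[R]_(size s) R^o _ f f_lin.
pose f' : {linear 'rV[R]_(size s) -> R^o} := HB.pack f L.
pose z := \sum_i f (delta_mx 0 i) *: tnth (in_tuple s) i.
have f_eval (g : topdual V) : f (T g) = g z.
  have -> : f (T g) = f' (T g) by [].
  rewrite [T g]row_sum_delta /z !linear_sum.
  by apply: eq_bigr => i _; rewrite !linearZ/= mxE; exact: mulrC.
have : F z <= 0 by apply: F_bipolar => b Bb; rewrite -f_eval; apply: fB; exists b.
by rewrite -f_eval leNgt fF.
Qed.

Lemma convex_cone_embed (B : set V) :
  convex_cone B -> convex_cone [set bidual_embed b | b in B].
Proof.
move=> [[b0 Bb0] BD BZ]; split; first by exists (bidual_embed b0), b0.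
- move=> _ _ [b Bb <-] [c Bc <-]; exists (b + c); first exact: BD.
  by apply: dualE => f; rewrite dualDE /= linearD.
- move=> t _ t0 [b Bb <-]; exists (t *: b); first exact: BZ.
  by apply: dualE => f; rewrite dualZE /= linearZ.
Qed.

Lemma set_add_cone (A B : set V) :
  convex_cone A -> convex_cone B -> convex_cone (set_add A B).
Proof.
move=> [[a0 Aa0] AD AZ] [[b0 Bb0] BD BZ]; split.
- by exists (a0 + b0), a0 => //; exists b0.
- move=> _ _ [a Aa [b Bb <-]] [a' Aa' [b' Bb' <-]]; rewrite addrACA.
  by exists (a + a'); [exact: AD|exists (b + b') => //; exact: BD].
- move=> t _ t0 [a Aa [b Bb <-]]; rewrite scalerDr.
  by exists (t *: a); [exact: AZ|exists (t *: b) => //; exact: BZ].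
Qed.

(** Each of the two cones contains [0], hence is contained in the sum. *)
Lemma polar_set_add (A B : set V) : convex_cone A -> convex_cone B ->
  polar (set_add A B) = polar A `&` polar B.
Proof.
move=> /convex_cone0 A0 /convex_cone0 B0; apply/seteqP; split.
  move=> f fAB; split=> x Hx; apply: fAB.
    by exists x => //; exists 0 => //; rewrite addr0.
  by exists 0 => //; exists x => //; rewrite add0r.
move=> f [fA fB] _ [a Aa [b Bb <-]]; rewrite linearD.
by apply: le_trans (lerD (fA a Aa) (fB b Bb)) _; rewrite addr0.
Qed.

Lemma polar_closure (A : set V) : polar (closure A) = polar A.
Proof.
apply/seteqP; split=> f fA x Ax; first by apply: fA; exact: subset_closure.
have f_closed : closed [set x | f x <= 0].
  have /continuous_closedP f_cont := @dual_continuous _ _ f.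
   exact: f_cont [set y : R^o | y <= 0] (@closed_le R 0).
by apply: f_closed; apply: closure_subset Ax; exact: fA.
Qed.

Lemma linear_subspace_cone (H : set V) : linear_subspace H -> convex_cone H.
Proof.
move=> [H0 HZD]; split; first by exists 0; exact: set_mem.
- move=> x y Hx Hy; apply: set_mem; rewrite -[x]scale1r.
  by apply: HZD; exact: mem_set.
- move=> t x _ Hx; apply: set_mem; rewrite -[t *: x]addr0.
  by apply: HZD => //; exact: mem_set.
Qed.

Lemma annihilator_subspace (A : set V) : linear_subspace (annihilator A).
Proof.
split; first by apply: mem_set.
move=> t f g /set_mem fA /set_mem gA; apply: mem_set => a Aa.
by rewrite dualDE dualZE fA// gA// mulr0 addr0.
Qed.

Lemma prepolar_cone (B : set (topdual V)) : convex_cone (prepolar B).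
Proof.
split; first by exists 0 => f _; rewrite linear0.
- move=> x y Bx By f Bf; rewrite linearD.
  by apply: le_trans (lerD (Bx f Bf) (By f Bf)) _; rewrite addr0.
- move=> t x t0 Bx f Bf; rewrite linearZ/=.
  by apply: mulr_ge0_le0 => //; exact: Bx.
Qed.

End Polarity.

(** * The embedded order unit and the duality gap *)

Section BidualOrder.
Context (R : realType) (X : banachLatticeType R) (e : X).
Hypotheses (he : order_unit e) (he_norm : order_unit_norm e).
Local Notation E := (bidual_embed e).

Lemma unit_pos (eta : topdual X) : dual_pos eta -> 0 <= eta e.
Proof. by apply; have [] := he. Qed.

Lemma dual_pos_le (eta : topdual X) x y : dual_pos eta -> vle x y -> eta x <= eta y.
Proof.
move=> eta_pos xy; rewrite -subr_ge0 -linearB; apply: eta_pos.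
by have := vleD2r (- x) x y xy; rewrite subrr.
Qed.

(** The unit ball lies between [- e] and [e] up to an arbitrarily small
    enlargement, which is all the definition of the norm as an infimum gives. *)
Lemma dual_pos_norm (eta : topdual X) : dual_pos eta -> `|eta| <= eta e.
Proof.
move=> eta_pos; apply: dual_norm_le => x x1; apply/ler_addgt0Pl => d d0.
pose I := [set c : R | vle (- (c *: e)) x /\ vle x (c *: e)].
have eta_e := unit_pos eta_pos.
have eta_x c : I c -> `|eta x| <= c * eta e.
  move=> [ex xe]; have <- : eta (c *: e) = c * eta e by rewrite linearZ.
  by rewrite ler_norml -linearN !dual_pos_le.
(* Chosen so that [c' * eta e <= eta e + d], also when [eta e = 0]. *)
pose c' := 1 + d / (eta e + 1).
have : exists2 c, I c & c < c'.
  apply: contrapT => noc.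
  have : c' <= inf I.
    apply: lb_le_inf => [|c Ic]; first by have [_ /(_ x)] := he.
    by rewrite leNgt; apply/negP => cc'; apply: noc; exists c.
  rewrite -he_norm => /le_trans/(_ x1); rewrite leNgt ltrDl divr_gt0//; lra.
move=> [c Ic /ltW cc']; apply: le_trans (eta_x c Ic) _.
apply: (@le_trans _ _ (c' * eta e)); first exact: ler_wpM2r.
rewrite /c' mulrDl mul1r [leLHS]addrC lerD2r mulrAC ler_pdivrMr ?ltr_wpDl//.
by rewrite ler_pM2l// lerDl.
Qed.

Lemma bidual_le_unit (z : topdual (topdual X)) (eta : topdual X) :
  dual_pos eta -> z eta <= `|z| * eta e.
Proof.
move=> eta_pos; apply: le_trans (ler_norm _) _.
apply: le_trans (dual_norm_apply z eta) _.
by apply: ler_wpM2l; [exact: (normr_ge0 z)|exact: dual_pos_norm].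
Qed.

Lemma bidual_negP (w : topdual (topdual X)) :
  bidual_neg X w <-> forall eta, dual_pos eta -> w eta <= 0.
Proof.
split=> [[z z_pos <-] eta /z_pos|w_neg]; first by rewrite -oppr_le0.
exists (- w) => [eta /w_neg|]; last by rewrite opprK.
by rewrite -oppr_ge0.
Qed.

Lemma bidual_neg_cone : convex_cone (bidual_neg X).
Proof.
split=> [|x y /bidual_negP x_neg /bidual_negP y_neg|t x t0 /bidual_negP x_neg].
- by exists 0; apply/bidual_negP.
- apply/bidual_negP => eta eta_pos; rewrite dualDE.
  by have := x_neg _ eta_pos; have := y_neg _ eta_pos; lra.
- apply/bidual_negP => eta eta_pos; rewrite dualZE.
  by apply: mulr_ge0_le0 => //; exact: x_neg.
Qed.

(** As the negative cone contains [0] and is the set of [w <= 0], this says that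
    [M] is a lower set for the order of the bidual. *)
Definition down_closed (M : set (topdual (topdual X))) :=
  forall z w, M z -> bidual_neg X w -> M (z + w).

Lemma down_closed_unit M (z : topdual (topdual X)) (c d : R) :
  down_closed M -> c <= d -> M (z - c *: E) -> M (z - d *: E).
Proof.
move=> M_down cd Mc.
have -> : z - d *: E = z - c *: E + (c - d) *: E.
  by rewrite scalerBl addrA subrK.
apply: M_down => //; apply/bidual_negP => eta eta_pos.
by rewrite dualZE mulr_le0_ge0 ?subr_le0//; exact: unit_pos.
Qed.

(** If [y] in [M] is within [eps] of [z], then [z - y <= eps E], so [z - eps E]
    lies below [y].  Conversely the points [z - eps E] converge to [z]. *)
Lemma down_closed_closureP M (z : topdual (topdual X)) : down_closed M ->
  closure M z <-> forall eps, 0 < eps -> M (z - eps *: E).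
Proof.
move=> M_down; split=> [clz eps eps0|Mz A /nbhs_normP[eps /= eps0 sA]].
  have [y [My zy]] : M `&` ball z eps !=set0 by apply: clz; exact: nbhsx_ballx.
  have -> : z - eps *: E = y + (z - y - eps *: E).
    by rewrite addrA [y + _]addrC subrK.
  apply: M_down => //; apply/bidual_negP => eta eta_pos.
  rewrite [X in X <= _]/((z - y) eta - eps * eta e) subr_le0.
  apply: le_trans (bidual_le_unit (z - y) eta_pos) _.
  by apply: ler_wpM2r; [exact: unit_pos|exact: ltW].
pose d := eps / (`|E| + 1).
have d0 : 0 < d by rewrite divr_gt0// ltr_wpDl.
exists (z - d *: E); split; first exact: Mz.
apply: sA; rewrite /= opprB addrC subrK normrZ gtr0_norm//.
rewrite /d mulrAC ltr_pdivrMr ?ltr_wpDl// ltr_pM2l// ltrDl//.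
Qed.

Lemma down_closed_closure M : down_closed M -> down_closed (closure M).
Proof.
move=> M_down z w /(down_closed_closureP _ M_down) Mz w_neg.
apply/(down_closed_closureP _ M_down) => eps eps0.
by rewrite addrAC; apply: M_down => //; exact: Mz.
Qed.

Lemma closure_convex_cone M :
  down_closed M -> convex_cone M -> convex_cone (closure M).
Proof.
move=> M_down [[x0 Mx0] MD MZ]; have clP := down_closed_closureP _ M_down.
split=> [|x y /clP Mx /clP My|t x t0 /clP Mx].
- by exists x0; exact: subset_closure.
- apply/clP => eps eps0; have eps2 : 0 < eps / 2 by rewrite divr_gt0.
  by rewrite [eps]splitr scalerDl opprD addrACA; apply: MD; [exact: Mx|exact: My].
- have [->|t_neq0] := eqVneq t 0.
    by rewrite scale0r -(scale0r x0); apply/subset_closure/MZ.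
  have t_gt0 : 0 < t by rewrite lt_def t_neq0.
  apply/clP => eps eps0.
  have -> : t *: x - eps *: E = t *: (x - (eps / t) *: E).
    by rewrite scalerBr scalerA mulrCA mulfV// mulr1.
  by apply: MZ => //; apply: Mx; rewrite divr_gt0.
Qed.

Section Gap.
Context (Q : set (topdual X)) (Q0 : Q !=set0).
Hypothesis Q_sphere : Q `<=` pos_sphere e.

Lemma primal_le (a : topdual (topdual X)) (c : R) :
  (primal a Q <= c%:E)%E <-> Kfrak Q (a - c *: E).
Proof.
have aE eta : Q eta -> (a - c *: E) eta = a eta - c.
  by move=> /Q_sphere[_ eta1]; rewrite [LHS]/(a eta - c * eta e) eta1 mulr1.
split=> [ac eta Qeta|Ka].
  rewrite aE// subr_le0 -lee_fin; apply: le_trans ac.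
  by apply: ereal_sup_ubound; exists eta.
apply: ge_ereal_sup => _ [eta Qeta <-].
by rewrite lee_fin -subr_le0 -aE//; exact: Ka.
Qed.

Lemma Kfrak_down : down_closed (Kfrak Q).
Proof.
move=> z w Kz /bidual_negP w_neg eta Qeta; rewrite dualDE.
have [eta_pos _] := Q_sphere Qeta.
by have := Kz _ Qeta; have := w_neg _ eta_pos; lra.
Qed.

Lemma Kfrak_closed : closed (Kfrak Q).
Proof.
move=> z /(down_closed_closureP _ Kfrak_down) Kz eta Qeta.
apply/ler_addgt0Pl => eps eps0; have [_ eta1] := Q_sphere Qeta.
have := Kz _ eps0 _ Qeta.
by rewrite [X in X <= _]/(z eta - eps * eta e) eta1 mulr1 subr_le0 addr0.
Qed.

(** Both values are compared on the scale [a - c E]: the primal value is the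
    least [c] for which this point is in [Kfrak Q], the dual value is the
    infimum of those for which it is in [M].  The former can be attained where
    the latter is not, and taking the closure of [M] absorbs the difference. *)
Theorem duality_gapP M : down_closed M ->
  (forall a, primal a Q = dual_value e a M) <-> closure M = Kfrak Q.
Proof.
move=> M_down; have clP := down_closed_closureP _ M_down.
split=> [gap|clM a].
  apply/seteqP; split=> z.
    move=> /clP Mz; apply: Kfrak_closed.
    apply/(down_closed_closureP _ Kfrak_down) => eps eps0; apply/primal_le.
    rewrite gap; apply: ereal_inf_lbound; exists eps => //=.
    by exists (z - eps *: E); [exact: Mz|rewrite addrC subrK].
  move=> Kz; apply/clP => eps eps0.
  have : (dual_value e z M < eps%:E)%E.
    rewrite -gap; apply: (@le_lt_trans _ _ 0%:E); last by rewrite lte_fin.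
    by apply/primal_le; rewrite scale0r subr0.
  move=> /ereal_inf_lt[_ [c [w Mw wz] <-]]; rewrite lte_fin => /ltW ceps.
  by apply: down_closed_unit ceps _ => //; rewrite -wz addrC addKr.
apply/eqP; rewrite eq_le; apply/andP; split.
  apply: le_ereal_inf_tmp => _ [c [z Mz <-] <-]; apply/primal_le.
  by rewrite addrC addKr -clM; exact: subset_closure.
case Pa : (primal a Q) => [r||]; last 2 first.
- by rewrite leey.
- have [eta Qeta] := Q0.
  have : ((a eta)%:E <= primal a Q)%E by apply: ereal_sup_ubound; exists eta.
  by rewrite Pa.
have : closure M (a - r *: E) by rewrite clM; apply/primal_le; rewrite Pa.
move=> /clP Ma; apply/lee_addgt0Pr => eps eps0; rewrite -EFinD.
apply: ereal_inf_lbound; exists (r + eps) => //=.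
exists (a - r *: E - eps *: E); first exact: Ma.
by rewrite scalerDl addrC -[a - _ - _]addrA -opprD subrK.
Qed.

End Gap.

End BidualOrder.

(** * The cones generated by the constraint set *)

Section ConeHull.
Context (R : realType) (X : banachLatticeType R) (Q : set (topdual X)).

Lemma cone_hull_cone : Q !=set0 -> convex_subset Q -> convex_cone (cone_hull Q).
Proof.
move=> [eta0 Qeta0] Q_convex; split.
- by exists (0 *: eta0), 0 => //=; exists eta0.
- move=> _ _ [s /= s0 [eta Qeta <-]] [t /= t0 [mu Qmu <-]].
  (* [s *: eta + t *: mu] is [s + t] times a convex combination, unless both
     coefficients vanish. *)
  have [st_eq0|st_neq0] := eqVneq (s + t) 0.
    have -> : s = 0 by lra.
    have -> : t = 0 by lra.
    by exists 0 => //=; exists eta0 => //; rewrite !scale0r addr0.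
  have st_gt0 : 0 < s + t by rewrite lt_def st_neq0 addr_ge0.
  have l0 : 0 <= s / (s + t) by rewrite divr_ge0// ltW.
  have l1 : s / (s + t) <= 1 by rewrite ler_pdivrMr// mul1r lerDl.
  exists (s + t); first exact: ltW.
  exists (s / (s + t) *: eta + (1 - s / (s + t)) *: mu).
    have := Q_convex eta mu (Itv01 l0 l1) (mem_set Qeta) (mem_set Qmu).
    exact: set_mem.
  rewrite scalerDr !scalerA mulrBr mulr1 mulrCA mulfV// mulr1.
  by rewrite addrAC subrr add0r.
- move=> t _ t0 [s /= s0 [eta Qeta <-]].
  by exists (t * s); [exact: mulr_ge0|exists eta; rewrite -?scalerA].
Qed.

Lemma span_hullE f g :
  cone_hull Q f -> cone_hull Q g -> span_hull Q (f - g).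
Proof. by move=> Qf Qg; exists f => //; exists g. Qed.

Lemma span_hull_cone : convex_cone (cone_hull Q) -> convex_cone (span_hull Q).
Proof.
move=> C_cone; have [[f0 Cf0] CD CZ] := C_cone; split.
- by exists (f0 - f0); exact: span_hullE.
- move=> _ _ [f Cf [g Cg <-]] [f' Cf' [g' Cg' <-]].
  by rewrite addrACA -opprD; apply: span_hullE; exact: CD.
- move=> t _ t0 [f Cf [g Cg <-]].
  by rewrite scalerBr; apply: span_hullE; exact: CZ.
Qed.

Lemma HhatP (z : topdual (topdual X)) :
  Hhat Q z <-> forall eta, Q eta -> z eta = 0.
Proof.
split=> [Hz eta Qeta|Qz _ [_ [s _ [eta Qeta <-]] [_ [t _ [mu Qmu <-]] <-]]].
  have -> : eta = 1 *: eta - 0 *: eta by rewrite scale1r scale0r subr0.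
  by apply/Hz/span_hullE; [exists 1|exists 0] => //=; exists eta.
by rewrite linearB !linearZ/= !Qz// oppr0 !scaler0 addr0.
Qed.

Lemma prepolar_cone_hull :
  prepolar [set bidual_embed eta | eta in cone_hull Q] = Kfrak Q.
Proof.
apply/seteqP; split=> [z Cz eta Qeta|z Kz _ [_ [t /= t0 [eta Qeta <-]] <-]].
  apply: (Cz (bidual_embed eta)); exists eta => //.
  by exists 1 => //=; exists eta => //; rewrite scale1r.
rewrite /= linearZ/=; apply: mulr_ge0_le0 => //; exact: Kz.
Qed.

(** A functional that is nonpositive on a subspace vanishes on it. *)
Lemma prepolar_span_hull :
  prepolar [set bidual_embed eta | eta in span_hull Q] = Hhat Q.
Proof.
apply/seteqP; split=> [z Az _ [f Cf [g Cg <-]]|z Hz _ [f Af <-]]; last first.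
  by rewrite /= Hz.
apply/eqP; rewrite eq_le (Az (bidual_embed (f - g))); last first.
  by exists (f - g) => //; exact: span_hullE.
have := Az (bidual_embed (g - f)); rewrite /= -opprB linearN oppr_le0; apply.
by exists (- (f - g)) => //; rewrite opprB; exact: span_hullE.
Qed.

End ConeHull.

(** * Equivalence of the four conditions *)

Lemma polar_bidual_neg (R : realType) (X : banachLatticeType R) :
  polar (bidual_neg X) = tridual_pos X.
Proof.
apply/seteqP; split=> f.
  move=> f_neg z z_pos; rewrite -oppr_le0 -linearN; apply: f_neg.
  by exists z.
by move=> f_pos _ [z z_pos <-]; rewrite linearN oppr_le0; exact: f_pos.
Qed.

Theorem theorem4p4 (R : realType) (X : banachLatticeType R) (e : X)
  (he : order_unit e) (he_norm : order_unit_norm e)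
  (Q : set (topdual X))
  (Q0 : Q !=set0) (Qclosed : closed Q) (Qconvex : convex_subset Q)
  (HQ : exists H : set X,
     [/\ linear_subspace H, closed H & Q = annihilator H `&` pos_sphere e]) :
  [<-> exists2 H : set (topdual (topdual X)),
         linear_subspace H & no_duality_gap e Q H;
       Afrak Q = Kfrak Q;
       forall a : topdual (topdual X), primal a Q = dual_value e a (Afrak Q);
       weak_star_closure [set bidual_embed eta | eta in span_hull Q]
         `&` tridual_pos X =
       weak_star_closure [set bidual_embed eta | eta in cone_hull Q]]
  /\ (forall H : set (topdual (topdual X)),
        linear_subspace H -> no_duality_gap e Q H ->
        H `<=` Hhat Q /\ closure (set_add H (bidual_neg X)) = Kfrak Q).
Proof.
have Q_sphere : Q `<=` pos_sphere e by have [H [_ _ ->]] := HQ => eta [].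
have gapP := duality_gapP he he_norm Q0 Q_sphere.
have neg_cone := bidual_neg_cone X.
have add_down H : down_closed (set_add H (bidual_neg X)).
  move=> _ w [h Hh [u u_neg <-]] w_neg; rewrite -addrA.
  by exists h => //; exists (u + w) => //; have [_ negD _] := neg_cone; exact: negD.
pose M := set_add (Hhat Q) (bidual_neg X).
have Hhat_cone : convex_cone (Hhat Q) := linear_subspace_cone (annihilator_subspace _).
have M_cone : convex_cone M by exact: set_add_cone.
have MK : M `<=` Kfrak Q.
  move=> _ [h /HhatP Hh [w w_neg <-]].
  apply: (Kfrak_down Q_sphere) => // eta Qeta; by rewrite Hh.
have K_closed : closed (Kfrak Q) by exact: Kfrak_closed Q_sphere.
have AK : Afrak Q `<=` Kfrak Q.
  by move/closure_id: K_closed => ->; exact: closure_subset.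
(* The last assertion, proved before the equivalences because it also yields
   that the first implies the second. *)
have gap_closure H : linear_subspace H -> no_duality_gap e Q H ->
    H `<=` Hhat Q /\ closure (set_add H (bidual_neg X)) = Kfrak Q.
  move=> H_sub /(gapP _ (add_down H)) clHK; split=> // h Hh.
  have HK h' : H h' -> Kfrak Q h'.
    move=> Hh'; rewrite -clHK; apply: subset_closure; exists h' => //.
    by exists 0; [exact: convex_cone0|rewrite addr0].
  apply/HhatP => eta Qeta; apply/eqP; rewrite eq_le HK//=.
  rewrite -oppr_le0; apply: (HK (- h)) => //.
  have [_ HZD] := H_sub.
  have := HZD (-1) h 0 (mem_set Hh) H_sub.1.
  by rewrite scaleN1r addr0 => /set_mem.
have C_cone : convex_cone (cone_hull Q) by exact: cone_hull_cone.
have A_cone : convex_cone (Afrak Q).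
  exact: (closure_convex_cone he he_norm (add_down _)).
have polarA : weak_star_closure [set bidual_embed eta | eta in span_hull Q]
    `&` tridual_pos X = polar (Afrak Q).
  rewrite weak_star_bipolar; last exact/convex_cone_embed/span_hull_cone.
  by rewrite prepolar_span_hull -polar_bidual_neg polar_closure polar_set_add.
have polarK : weak_star_closure [set bidual_embed eta | eta in cone_hull Q]
    = polar (Kfrak Q).
  rewrite weak_star_bipolar; last exact: convex_cone_embed.
  by rewrite prepolar_cone_hull.
have closureA : closure (Afrak Q) = Afrak Q.
  by apply/esym/closure_id; exact: closed_closure.
have A_down : down_closed (Afrak Q).
  exact: (down_closed_closure he he_norm (add_down _)).
split=> //; tfae.
- move=> [H H_sub /(gap_closure H H_sub)[H_le clHK]].
  apply/seteqP; split=> //; rewrite -clHK; apply: closure_subset.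
  by move=> _ [h Hh [w w_neg <-]]; exists h; [exact: H_le|exists w].
- by move=> AKe; apply/(gapP _ A_down); rewrite closureA.
- by move=> /(gapP _ A_down); rewrite closureA polarA polarK => ->.
- rewrite polarA polarK => polarE; exists (Hhat Q).
    exact: annihilator_subspace.
  apply/(gapP _ (add_down _)); rewrite -[LHS]/(Afrak Q).
  rewrite -[LHS]prepolar_polar//; last exact: closed_closure.
  by rewrite polarE prepolar_polar// -prepolar_cone_hull; exact: prepolar_cone.
Qed.
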